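(* Let $D$ be an integral domain which is semiprimitive. Then $C(\mathrm{Max}(D))\cong\mathbb{R}$ as rings.
   Context: $\mathrm{Max}(D)$ is the set of maximal ideals of $D$ with the Zariski (hull-kernel) topology, whose closed sets are the sets $\{M\in\mathrm{Max}(D): S\subseteq M\}$ for $S\subseteq D$. A commutative ring is semiprimitive if the intersection of all its maximal ideals is $\{0\}$. For a topological space $X$, $C(X)$ is the ring of all real-valued continuous functions on $X$ with pointwise operations. *)

(* Defs.v *)
From HB Require Import structures.
From mathcomp Require Import all_boot all_order all_algebra.
From mathcomp Require Import all_classical all_reals all_analysis.

Set Implicit Arguments.
Unset Strict Implicit.
Unset Printing Implicit Defensive.

Import Order.TTheory GRing.Theory Num.Theory.
Import numFieldNormedType.Exports.

Local Open Scope classical_set_scope.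
Local Open Scope ring_scope.

(* [idealr_closed] is the library's predicate for proper ideals: it includes
   [1 \notin M]. *)
Definition maximal_ideal (D : comNzRingType) (M : {pred D}) : Prop :=
  idealr_closed M /\
  forall J : {pred D}, idealr_closed J -> {subset M <= J} -> J = M.

Definition semiprimitive (D : comNzRingType) : Prop :=
  \bigcap_(M in @maximal_ideal D) [set` M] = [set 0].

Record Max (D : comNzRingType) := MkMax {
  max_pred :> {pred D};
  maxP : maximal_ideal max_pred
}.

HB.instance Definition _ (D : comNzRingType) := gen_eqMixin (Max D).
HB.instance Definition _ (D : comNzRingType) := gen_choiceMixin (Max D).

Definition hull (D : comNzRingType) (S : set D) : set (Max D) :=
  [set M : Max D | S `<=` [set` (M : {pred D})]].

(* The library builds topologies from open sets; [zariski_closedP] below shows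
   that the closed sets of the resulting topology are exactly the hulls. *)
Definition zariski_open (D : comNzRingType) : set_system (Max D) :=
  [set U | exists S : set D, ~` U = hull S].

Section MaxTopology.
Variable D : comNzRingType.
Implicit Types M : Max D.

Lemma max_ideal_prime M (s t : D) :
  s * t \in (M : {pred D}) -> s \notin (M : {pred D}) ->
  t \in (M : {pred D}).
Proof.
case: M => P [[P0 P1 Pc] Pmax] /= st sP.
have PD u v : u \in P -> v \in P -> u + v \in P.
  by move=> uP vP; have := Pc 1 u v uP vP; rewrite mul1r.
have PM a u : u \in P -> a * u \in P.
  by move=> uP; have := Pc a u 0 uP P0; rewrite addr0.
pose J : {pred D} := [pred x | `[< exists2 m, m \in P & exists a, x = m + a * s >]].
have JE x : x \in J = `[< exists2 m, m \in P & exists a, x = m + a * s >] by [].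
have PJ : {subset P <= J}.
  by move=> x xP; rewrite JE; apply/asboolP; exists x => //; exists 0; rewrite mul0r addr0.
have sJ : s \in J.
  by rewrite JE; apply/asboolP; exists 0 => //; exists 1; rewrite mul1r add0r.
have [J1|J1] := boolP (1 \in J); last first.
  have JP : J = P.
    apply: Pmax => //; split; [exact: PJ|exact: J1|].
    move=> a u v; rewrite !JE => /asboolP[m mP [b ->]] /asboolP[n nP [c ->]].
    apply/asboolP; exists (a * m + n); first exact: Pc.
    by exists (a * b + c); rewrite mulrDr mulrDl mulrA addrACA.
  by rewrite -JP sJ in sP.
move: J1; rewrite JE => /asboolP[m mP [a e1]].
have -> : t = t * m + a * (s * t).
  by rewrite -[LHS]mulr1 e1 mulrDr; congr (_ + _); rewrite mulrC mulrA.
by apply: PD; apply: PM.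
Qed.

Lemma hull_setT : hull [set: D] = set0.
Proof.
apply/seteqP; split=> // M /(_ 1 I) /= M1.
by have [[_ /negP + _] _] := maxP M; apply.
Qed.

Lemma hullU (S T : set D) :
  hull S `|` hull T = hull [set s * t | s in S & t in T].
Proof.
apply/seteqP; split=> M /=.
  have [[M0 _ Mc] _] := maxP M.
  have MM a u : u \in (M : {pred D}) -> a * u \in (M : {pred D}).
    by move=> uM; have := Mc a u 0 uM M0; rewrite addr0.
  by move=> [] SM _ [s Ss [t Tt <-]] /=; [rewrite mulrC|]; apply: MM; apply: SM.
move=> STM; have [|/existsNP[s /not_implyP[Ss /negP sM]]] := pselect (S `<=` [set` (M : {pred D})]).
  by left.
right=> t Tt /=; apply: max_ideal_prime sM.
by apply: STM; exists s => //; exists t.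
Qed.

Lemma hull_bigcup (J : Type) (S : J -> set D) :
  \bigcap_i hull (S i) = hull (\bigcup_i S i).
Proof.
apply/seteqP; split=> M /= h.
  by move=> x [i _ Six]; exact: (h i I x Six).
by move=> i _ x Six; apply: h; exists i.
Qed.

Lemma zariski_openT : zariski_open [set: Max D].
Proof. by exists setT; rewrite hull_setT setCT. Qed.

Lemma zariski_openI : setI_closed (@zariski_open D).
Proof.
move=> A B [S SA] [T TB]; exists [set s * t | s in S & t in T].
by rewrite setCI SA TB hullU.
Qed.

Lemma zariski_open_bigU (J : Type) (f : J -> set (Max D)) :
  (forall i, zariski_open (f i)) -> zariski_open (\bigcup_i f i).
Proof.
move=> /choice[S SE]; exists (\bigcup_i S i).
by rewrite setC_bigcup -hull_bigcup; apply: eq_bigcapr => i _; exact: SE.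
Qed.

HB.instance Definition _ := isOpenTopological.Build (Max D)
  zariski_openT zariski_openI zariski_open_bigU.

Lemma zariski_closedP (F : set (Max D)) :
  closed F <-> exists S : set D, F = hull S.
Proof.
rewrite -openC; split=> -[S]; first by rewrite setCK => ->; exists S.
by move=> FS; exists S; rewrite setCK.
Qed.

End MaxTopology.

Definition cfun (X : topologicalType) (R : realType) : {pred X -> R} :=
  mem [set f : X -> R | continuous f].

Section ContinuousRing.
Variables (X : topologicalType) (R : realType).
Local Notation T := (continuousType X R).

Lemma cfun_subring_closed : subring_closed (@cfun X R).
Proof.
split=> [|f g|f g]; rewrite !inE/=.
- by move=> x; exact: cvg_cst.
- by move=> fc gc x; apply: cvgB; [exact: fc|exact: gc].
- by move=> fc gc x; apply: cvgM; [exact: fc|exact: gc].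
Qed.

HB.instance Definition _ :=
  GRing.isSubringClosed.Build (X -> R) (@cfun X R) cfun_subring_closed.

Definition cfun_Sub (f : X -> R) (fP : f \in @cfun X R) : T :=
  mkcts (set_mem fP).

Lemma cfun_rect (K : T -> Type) :
  (forall f (Pf : f \in @cfun X R), K (cfun_Sub Pf)) -> forall u : T, K u.
Proof.
move=> Ksub u.
have uP : (u : X -> R) \in @cfun X R by rewrite inE; exact: cts_fun.
suff -> : u = cfun_Sub uP by exact: Ksub.
exact/continuousEP.
Qed.

Lemma cfun_valP (f : X -> R) (Pf : f \in @cfun X R) :
  cfun_Sub Pf = f :> (X -> R).
Proof. by []. Qed.

HB.instance Definition _ := isSub.Build _ _ T cfun_rect cfun_valP.
HB.instance Definition _ := GRing.SubChoice_isSubComPzRing.Build (X -> R) _ T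
  cfun_subring_closed.

Lemma cfun0E (x : X) : (0 : T) x = 0. Proof. by []. Qed.
Lemma cfun1E (x : X) : (1 : T) x = 1. Proof. by []. Qed.
Lemma cfunNE (f : T) (x : X) : (- f) x = - f x. Proof. by []. Qed.
Lemma cfunDE (f g : T) (x : X) : (f + g) x = f x + g x. Proof. by []. Qed.
Lemma cfunME (f g : T) (x : X) : (f * g) x = f x * g x. Proof. by []. Qed.

End ContinuousRing.

(* Main.v *)
Require Import Defs.
From HB Require Import structures.
From mathcomp Require Import all_boot all_order all_algebra.
From mathcomp Require Import all_classical all_reals all_analysis.
Import numFieldNormedType.Exports.

(** Any two nonempty open subsets of [Max D] meet: points [x] and [y] of them
    lie in basic open sets given by nonzero elements [s] and [t] with [s]
    outside [x] and [t] outside [y]; as [D] is a domain [s * t] is nonzero, so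
    by semiprimitivity some maximal ideal avoids [s * t], hence both [s] and
    [t] ([max_cluster]). In such a space no two points can be separated, so a
    continuous map into a Hausdorff space identifies all points
    ([continuous_cluster_eq]). Hence every real-valued continuous function is
    constant, and evaluation at any point of [Max D] is an isomorphism onto the
    reals whose inverse sends a real to the constant function. *)

Local Open Scope classical_set_scope.
Local Open Scope ring_scope.

Import GRing.Theory.

(** [cluster (nbhs x) y] says that [x] and [y] have no disjoint neighbourhoods.
    Pulling back along [f], disjoint neighbourhoods of [f x] and [f y] would
    give disjoint neighbourhoods of [x] and [y]. *)
Lemma continuous_cluster_eq (X Y : topologicalType) (f : X -> Y) (x y : X) :
  hausdorff_space Y -> continuous f -> cluster (nbhs x) y -> f x = f y.
Proof.
move=> hY fc xy; apply: hY => A B /(fc x) fA /(fc y) fB.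
by have [z [Az Bz]] := xy _ _ fA fB; exists (f z).
Qed.

Section Evaluation.
Variables (X : topologicalType) (R : realType) (x : X).

Definition cfun_eval (f : continuousType X R) : R := f x.

Lemma cfun_eval_zmod_morphism : zmod_morphism cfun_eval.
Proof. by []. Qed.

Lemma cfun_eval_monoid_morphism : monoid_morphism cfun_eval.
Proof. by []. Qed.

HB.instance Definition _ := GRing.isZmodMorphism.Build
  (continuousType X R) R cfun_eval cfun_eval_zmod_morphism.
HB.instance Definition _ := GRing.isMonoidMorphism.Build
  (continuousType X R) R cfun_eval cfun_eval_monoid_morphism.

Lemma cfun_eval_bijective :
  (forall y : X, cluster (nbhs x) y) -> bijective cfun_eval.
Proof.
move=> xX; exists (fun c => mkcts (@cst_continuous X R c) : continuousType X R) => //.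
move=> f; apply/continuousEP => y /=.
apply: continuous_cluster_eq (xX y); first exact: norm_hausdorff.
exact: cts_fun.
Qed.

End Evaluation.

Lemma max_ideal0 (D : comNzRingType) (M : Max D) : 0 \in (M : {pred D}).
Proof. by have [[]] := maxP M. Qed.

Lemma max_idealMl (D : comNzRingType) (M : Max D) (a s : D) :
  s \in (M : {pred D}) -> a * s \in (M : {pred D}).
Proof.
have [[M0 _ Mc] _] := maxP M.
by move=> sM; rewrite -[a * s]addr0; exact: Mc.
Qed.

Lemma semiprimitive_avoid {D : comNzRingType} (s : D) :
  semiprimitive D -> s != 0 -> exists M : Max D, s \notin (M : {pred D}).
Proof.
move=> Dss /eqP s0; apply: contrapT => avoid; apply: s0.
suff : [set 0] s by [].
rewrite -Dss => P Pmax /=; apply/negPn/negP => sP.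
by apply: avoid; exists (MkMax Pmax).
Qed.

(** A closed set [hull S] is the intersection of the hulls of the single
    elements of [S], so a point outside it already lies outside the hull of one
    [s]; the complement of that hull is a basic neighbourhood of the point. *)
Lemma nbhs_max_basic (D : comNzRingType) (x : Max D) (A : set (Max D)) :
  nbhs x A -> exists2 s : D, s \notin (x : {pred D}) &
    forall M : Max D, s \notin (M : {pred D}) -> A M.
Proof.
rewrite nbhsE => -[U [oU Ux] UA].
have [S US] := (zariski_closedP (~` U)).1 (open_closedC oU).
have : ~ hull S x by rewrite -US; apply.
move=> /existsNP[s /not_implyP[Ss /negP sx]]; exists s => // M sM.
apply: UA; apply: contrapT => UM.
have : hull S M by rewrite -US.
by move=> /(_ s Ss) /=; apply/negP.
Qed.

(** An ideal avoiding [s * t] avoids both factors. This is where the absence of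
    zero divisors enters: it makes [s * t] nonzero, so that semiprimitivity
    provides such a maximal ideal. *)
Lemma max_cluster (D : idomainType) (x y : Max D) :
  semiprimitive D -> cluster (nbhs x) y.
Proof.
move=> Dss A B /nbhs_max_basic[s sx sA] /nbhs_max_basic[t ty tB].
have st0 : s * t != 0.
  rewrite mulf_neq0//.
  - by apply: contraNneq sx => ->; exact: max_ideal0.
  - by apply: contraNneq ty => ->; exact: max_ideal0.
have [M stM] := semiprimitive_avoid _ Dss st0.
exists M; split.
- by apply: sA; apply: contra stM => sM; rewrite mulrC; exact: max_idealMl.
- by apply: tB; apply: contra stM => tM; exact: max_idealMl.
Qed.

Theorem theorem4p16 (R : realType) (D : idomainType) :
  semiprimitive D ->
  exists f : {rmorphism (continuousType (Max D) R) -> R}, bijective f.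
Proof.
move=> Dss.
(* Without maximal ideals their empty intersection would be all of [D], so
   semiprimitivity already provides a point to evaluate at. *)
have [x _] := semiprimitive_avoid 1 Dss (oner_neq0 D).
exists (@cfun_eval (Max D) R x : {rmorphism _ -> _}).
by apply: cfun_eval_bijective => y; exact: max_cluster.
Qed.
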